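(* Let $\langle\phi,\vec{a}\rangle$ be a loop with $\phi(\vec{x})\equiv\bigwedge_{i=1}^k C_i$, where each clause $C_i$ contains a literal $\mathit{expr}_i(\vec{x})>0$ such that for all $\vec{x}\in\mathbb{Z}^d$: $\mathit{expr}_i(\vec{x})\le\mathit{expr}_i(\vec{a}(\vec{x}))\implies\mathit{expr}_i(\vec{a}(\vec{x}))\le\mathit{expr}_i(\vec{a}^2(\vec{x}))$. Then the formula $\vec{x}'=\vec{a}^n(\vec{x})\land\bigwedge_{i=1}^k 0<\mathit{expr}_i(\vec{x})\le\mathit{expr}_i(\vec{a}(\vec{x}))$ approximates $\langle\phi,\vec{a}\rangle$ (so the acceleration technique mapping such loops to this formula is sound).
   Context: $\vec{x}=(x_1,\dots,x_d)$ ranges over $\mathbb{Z}^d$, $n$ is a variable, $\vec{x}'=(x_1',\dots,x_d')$. Formulas are finite quantifier-free propositional formulas in CNF with atoms $p>0$, $p$ a closed-form arithmetic expression. A loop $\langle\phi,\vec{a}\rangle$ consists of a formula $\phi$ over $\vec{x}$ and $\vec{a}:\mathbb{Z}^d\to\mathbb{Z}^d$ given by closed-form expressions; it induces $\vec{x}\longrightarrow_{\langle\phi,\vec{a}\rangle}\vec{x}'$ iff $\phi(\vec{x})\land\vec{x}'=\vec{a}(\vec{x})$, with $\longrightarrow^n$ its $n$-fold composition; $\vec{a}^n$ is the $n$-fold application of $\vec{a}$. A formula $\psi$ over $(\vec{x},n,\vec{x}')$ approximates the loop if for all $n>0$ and $\vec{x},\vec{x}'\in\mathbb{Z}^d$,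 $\psi\implies\vec{x}\longrightarrow^n_{\langle\phi,\vec{a}\rangle}\vec{x}'$. *)

(* Defs.v *)
From Stdlib Require List.
From HB Require Import structures.
From mathcomp Require Import all_boot all_order all_algebra.
From mathcomp Require Import all_classical all_reals all_analysis.

Set Implicit Arguments.
Unset Strict Implicit.
Unset Printing Implicit Defensive.

Import Order.TTheory GRing.Theory Num.Theory.

Local Open Scope ring_scope.

(* The class of closed forms is open-ended: besides the usual arithmetic
   operations, expressions may use any further primitive operations provided
   here (none, if [prim] is empty). *)
Record primitives (R : realType) := Primitives {
  prim : Type;
  prim_fun : prim -> seq R -> R }.

Inductive expr (R : realType) (S : primitives R) (d : nat) : Type :=
| EVar of 'I_d
| EConst of int
| EAdd of expr S d & expr S d
| ESub of expr S d & expr S d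
| EMul of expr S d & expr S d
| EDiv of expr S d & expr S d
| EExp of expr S d & expr S d
| EPrim of prim S & seq (expr S d).

(* [powR] is meaningful for nonnegative bases only; integer exponents get the
   algebraic power, so that e.g. (-1)^3 = -1. *)
Definition real_exp (R : realType) (x y : R) : R :=
  if y \is a Num.int then x ^ Num.floor y else x `^ y.

(* Division by zero yields 0. *)
Fixpoint expr_eval (R : realType) (S : primitives R) (d : nat)
    (x : 'rV[int]_d) (e : expr S d) {struct e} : R :=
  match e with
  | EVar j => (x 0 j)%:~R
  | EConst c => c%:~R
  | EAdd e1 e2 => expr_eval x e1 + expr_eval x e2
  | ESub e1 e2 => expr_eval x e1 - expr_eval x e2
  | EMul e1 e2 => expr_eval x e1 * expr_eval x e2
  | EDiv e1 e2 => expr_eval x e1 / expr_eval x e2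
  | EExp e1 e2 => real_exp (expr_eval x e1) (expr_eval x e2)
  | EPrim f es => prim_fun f (map (expr_eval x) es)
  end.

(* [Pos p] is the atom p > 0, [Neg p] its negation. *)
Inductive literal (R : realType) (S : primitives R) (d : nat) : Type :=
| Pos of expr S d
| Neg of expr S d.

Definition clause (R : realType) (S : primitives R) (d : nat) : Type :=
  seq (literal S d).

Definition formula (R : realType) (S : primitives R) (d : nat) : Type :=
  seq (clause S d).

Definition holds_literal (R : realType) (S : primitives R) (d : nat)
    (x : 'rV[int]_d) (l : literal S d) : bool :=
  match l with
  | Pos p => 0 < expr_eval x p
  | Neg p => ~~ (0 < expr_eval x p)
  end.

Definition holds (R : realType) (S : primitives R) (d : nat)
    (x : 'rV[int]_d) (phi : formula S d) : bool :=
  all (has (holds_literal x)) phi.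

(* Expressions are real-valued, so that the update maps Z^d to Z^d is a
   requirement on the expressions describing it. *)
Record loop (R : realType) (S : primitives R) (d : nat) := Loop {
  guard : formula S d;
  update_expr : 'I_d -> expr S d;
  update : 'rV[int]_d -> 'rV[int]_d;
  update_exprE : forall x j, (update x 0 j)%:~R = expr_eval x (update_expr j) }.

Definition step (R : realType) (S : primitives R) (d : nat) (L : loop S d)
    (x x' : 'rV[int]_d) : Prop :=
  holds x (guard L) /\ x' = update L x.

Fixpoint rel_iter (T : Type) (r : T -> T -> Prop) (n : nat) (x z : T) : Prop :=
  match n with
  | 0%N => x = z
  | m.+1 => exists2 y, r x y & rel_iter r m y z
  end.

(* A formula over (x, n, x') is given by the relation it denotes: it may refer
   to the n-fold iterate of an update, which need not be an [expr]. *)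
Definition approximates (R : realType) (S : primitives R) (d : nat)
    (psi : 'rV[int]_d -> nat -> 'rV[int]_d -> Prop) (L : loop S d) : Prop :=
  forall (n : nat) (x x' : 'rV[int]_d),
    (0 < n)%N -> psi x n x' -> rel_iter (step L) n x x'.

(* Main.v *)
(* The condition 0 < expr_i(x) <= expr_i(a(x)) implies the guard at x, and by
   the monotonicity hypothesis it is preserved by the update. *)
Require Import Defs.
From Stdlib Require List.
From HB Require Import structures.
From mathcomp Require Import all_boot all_order all_algebra.
From mathcomp Require Import all_classical all_reals all_analysis.

Set Implicit Arguments.
Unset Strict Implicit.
Unset Printing Implicit Defensive.

Import Order.TTheory GRing.Theory Num.Theory.

Local Open Scope ring_scope.

(** Induction on [n] over all starting points: the invariant makes one literal of each clause true,
    so the loop can step, and it passes on to [update L x], where the remaining steps begin. *)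

(** Membership is [List.In] because literals, built over an arbitrary type of primitives, carry no
    decidable equality. *)
Lemma has_In (T : Type) (p : pred T) (a : T) (s : seq T) :
  List.In a s -> p a -> has p s.
Proof.
by elim: s => //= b s IHs [-> -> // | as_in pa]; rewrite IHs ?orbT.
Qed.

Theorem theorem12 (R : realType) (S : primitives R) (d k : nat) (L : loop S d)
    (C : k.-tuple (clause S d)) (e : 'I_k -> expr S d)
    (guardE : guard L = tval C)
    (e_lit : forall i : 'I_k, List.In (Pos (e i)) (tnth C i))
    (e_mono : forall (i : 'I_k) (x : 'rV[int]_d),
       expr_eval x (e i) <= expr_eval (update L x) (e i) ->
       expr_eval (update L x) (e i) <= expr_eval (iter 2 (update L) x) (e i)) :
  approximates
    (fun x n x' =>
       x' = iter n (update L) x /\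
       forall i : 'I_k, 0 < expr_eval x (e i) <= expr_eval (update L x) (e i))
    L.
Proof.
move=> n x x' _ [-> {x'}]; elim: n x => [//|n IHn] x inv_x.
exists (update L x).
  split=> //; rewrite /holds guardE; apply/all_tnthP => i.
  by apply: has_In (e_lit i) _; case/andP: (inv_x i).
(* [rel_iter] peels off the first step, so the innermost update is split from [iter]. At
   [update L x], positivity follows from growth at [x], and growth from [e_mono]. *)
rewrite iterSr; apply: IHn => i; have /andP[e_gt0 e_le] := inv_x i.
by rewrite (lt_le_trans e_gt0 e_le) e_mono.
Qed.
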